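(* Consider an instance of the UKPB with item types $j=1,\dots,n'$, profits and weights $p_j,w_j\in\mathbb{N}^+$ with $p_j,w_j\le R$, ordered so that $p_1/w_1\ge\dots\ge p_{n'}/w_{n'}$, and let $N_1=\{j : p_j/w_j=p_1/w_1\}$. Then for any capacity $c\in\mathbb{N}$ (arbitrarily large), an optimal solution of the subproblem: maximize $\sum_{j\in N_1}p_jx_j$ subject to $\sum_{j\in N_1}w_jx_j\le c$, $x_j\in\mathbb{N}$, can be computed exactly in time $O(R^3)$ and space $O(R^2)$, independently of $c$.
   Context: The UKPB: maximize $\sum_{j=1}^{n'}p_jx_j$ subject to $\sum_{j=1}^{n'}w_jx_j\le C$, $x_j\in\mathbb{N}$, with $p_j,w_j\in\mathbb{N}^+$, $p_j,w_j\le R$ for a given positive integer $R$; dominated types are removed so that the number of types is at most $R$. Complexities count arithmetic operations, each (including on numbers of size $c$) taken as unit cost. $p_j/w_j$ is the profit density of type $j$. *)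

(* Defs.v *)
From mathcomp Require Import all_boot all_order all_algebra.
Set Implicit Arguments.
Unset Strict Implicit.
Unset Printing Implicit Defensive.
Import Order.TTheory GRing.Theory Num.Theory.

Definition density n (p w : 'I_n -> nat) (j : 'I_n) : rat :=
  ((p j)%:R / (w j)%:R)%R.

(* Item types are numbered from 0, so the first type is [ord0]. *)
Definition best_types n (p w : 'I_n.+1 -> nat) : {set 'I_n.+1} :=
  [set j | density p w j == density p w ord0].

(* The unbounded knapsack problem whose only variables are the [x j] with
   [j \in N]; the values of [x] outside [N] are irrelevant. *)
Definition feasible n (N : {set 'I_n}) (w : 'I_n -> nat) (c : nat)
    (x : 'I_n -> nat) : Prop :=
  \sum_(j in N) w j * x j <= c.

Definition optimal n (N : {set 'I_n}) (p w : 'I_n -> nat) (c : nat)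
    (x : 'I_n -> nat) : Prop :=
  feasible N w c x /\
  forall y : 'I_n -> nat, feasible N w c y ->
    \sum_(j in N) p j * y j <= \sum_(j in N) p j * x j.

(* A unit-cost random access machine, programmed in a while language.  The
   memory consists of cells [(a, i)]: position [i] of the array [a].  Array
   names are literals of the program, positions are computed; a scalar variable
   is a cell with a literal position. *)
Definition cell := (nat * nat)%type.
Definition store := cell -> nat.

Inductive binop := OpAdd | OpSub | OpMul | OpDiv | OpMod | OpEq | OpLt.

(* Subtraction is truncated, and division by 0 returns 0. *)
Definition apply_binop (o : binop) (x y : nat) : nat :=
  match o with
  | OpAdd => x + y
  | OpSub => x - y
  | OpMul => x * y
  | OpDiv => x %/ y
  | OpMod => x %% y
  | OpEq => x == y
  | OpLt => x < y
  end.

Inductive expr :=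
  | Const of nat
  | Read of nat & expr
  | Bin of binop & expr & expr.

Inductive cmd :=
  | Skip
  | Write of nat & expr & expr
  | Seq of cmd & cmd
  | If of expr & cmd & cmd
  | While of expr & cmd.

(* [time_used] counts elementary operations, [touched] lists the cells read or
   written, and [peak] is the largest number handled. *)
Record usage := Usage { time_used : nat; touched : seq cell; peak : nat }.

Definition add_usage (u v : usage) : usage :=
  Usage (time_used u + time_used v) (touched u ++ touched v)
    (maxn (peak u) (peak v)).

Definition space_used (u : usage) : nat := size (undup (touched u)).

Definition tick : usage := Usage 1 [::] 0.

Fixpoint eval (s : store) (e : expr) : nat * usage :=
  match e with
  | Const k => (k, Usage 1 [::] k)
  | Read a e1 =>
      let: (i, u) := eval s e1 in
      (s (a, i), add_usage u (Usage 1 [:: (a, i)] (s (a, i))))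
  | Bin o e1 e2 =>
      let: (x, u) := eval s e1 in
      let: (y, v) := eval s e2 in
      let z := apply_binop o x y in
      (z, add_usage (add_usage u v) (Usage 1 [::] z))
  end.

Definition update (s : store) (l : cell) (v : nat) : store :=
  fun l' => if l' == l then v else s l'.

(* [exec k s u s']: started in [s], the program [k] halts in [s'], having used
   the resources [u].  A guard is true when it is nonzero. *)
Inductive exec : cmd -> store -> usage -> store -> Prop :=
  | exec_skip s : exec Skip s tick s
  | exec_write s a ei ev i v ui uv :
      eval s ei = (i, ui) -> eval s ev = (v, uv) ->
      exec (Write a ei ev) s
        (add_usage (add_usage ui uv) (Usage 1 [:: (a, i)] v))
        (update s (a, i) v)
  | exec_seq k1 k2 s1 s2 s3 u1 u2 :
      exec k1 s1 u1 s2 -> exec k2 s2 u2 s3 ->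
      exec (Seq k1 k2) s1 (add_usage u1 u2) s3
  | exec_if e k1 k2 s s' b ub u :
      eval s e = (b, ub) -> exec (if b != 0 then k1 else k2) s u s' ->
      exec (If e k1 k2) s (add_usage (add_usage tick ub) u) s'
  | exec_while_stop e k s ub :
      eval s e = (0, ub) ->
      exec (While e k) s (add_usage tick ub) s
  | exec_while_loop e k s1 s2 s3 b ub u1 u2 :
      eval s1 e = (b, ub) -> b != 0 ->
      exec k s1 u1 s2 -> exec (While e k) s2 u2 s3 ->
      exec (While e k) s1
        (add_usage (add_usage (add_usage tick ub) u1) u2) s3.

(* Array 0 holds the number of types, the bound [R] and the capacity; arrays 1
   and 2 hold the profits and the weights.  All other cells are initially 0. *)
Definition input_store (R n : nat) (p w : 'I_n -> nat) (c : nat) : store :=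
  fun l =>
    match l.1 with
    | 0 => nth 0 [:: n; R; c] l.2
    | 1 => oapp p 0 (insub l.2)
    | 2 => oapp w 0 (insub l.2)
    | _ => 0
    end.

Definition output (s : store) n (j : 'I_n) : nat := s (3, val j).

(* Main.v *)
Require Import Defs.
From mathcomp Require Import all_boot all_order all_algebra zify.
Set Implicit Arguments.
Unset Strict Implicit.
Unset Printing Implicit Defensive.

(* All types in [best_types p w] have the same density, so the problem is to
   pack a total weight as close to [c] as possible.  Let [w0 <= R] be the weight
   of the first type.  By the pigeonhole principle on prefix sums modulo [w0],
   a packing of weight [t >= R * w0] can be turned into one of weight [t - w0].
   Hence [(c - R ^ 2) %/ w0] copies of the first type can be set aside without
   loss; the remaining capacity is at most [R ^ 2 + R], and is handled by
   dynamic programming over all weights, in O(R) operations per weight. *)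

(** * Attainable weights and the exchange argument *)

(** A packing is a list of items, not a vector of multiplicities, so that it has prefixes to which
    the pigeonhole principle applies. *)
Definition reachable n (N : {set 'I_n}) (w : 'I_n -> nat) (t : nat) : Prop :=
  exists2 s : seq 'I_n, all (mem N) s & \sum_(j <- s) w j = t.

Lemma reachable0 n (N : {set 'I_n}) w : reachable N w 0.
Proof. by exists [::]; rewrite ?big_nil. Qed.

Lemma reachableD n (N : {set 'I_n}) w t1 t2 :
  reachable N w t1 -> reachable N w t2 -> reachable N w (t1 + t2).
Proof.
move=> [s1 N1 <-] [s2 N2 <-]; exists (s1 ++ s2); last by rewrite big_cat.
by rewrite all_cat N1.
Qed.

Lemma reachableM n (N : {set 'I_n}) w j k :
  j \in N -> reachable N w (w j * k).
Proof.
move=> jN; exists (nseq k j); last by rewrite big_nseq iter_addn_0.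
by rewrite all_nseq /= jN orbT.
Qed.

Lemma reachable_sum n (N : {set 'I_n}) w (y : 'I_n -> nat) :
  reachable N w (\sum_(j in N) w j * y j).
Proof.
apply: (big_ind (reachable N w)) => [|t1 t2|j jN].
- exact: reachable0.
- exact: reachableD.
- exact: reachableM.
Qed.

Lemma prefix_sums_congruent n (w : 'I_n -> nat) m (s : seq 'I_n) :
  0 < m <= size s ->
  exists a b, a < b <= size s /\
    \sum_(j <- take a s) w j = \sum_(j <- take b s) w j %[mod m].
Proof.
case/andP=> m0 ms.
(* The [m.+1] prefixes of lengths 0 to [m] have only [m] possible residues. *)
pose f (i : 'I_m.+1) : 'I_m := Ordinal (ltn_pmod (\sum_(j <- take i s) w j) m0).
have /injectivePn[x [y xy fxy]] : ~~ injectiveb f.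
  by apply/negP => /injectiveP/leq_card; rewrite !card_ord ltnn.
have {fxy} : \sum_(j <- take x s) w j = \sum_(j <- take y s) w j %[mod m].
  by move/(congr1 val): fxy.
wlog lt_xy : x y xy / x < y => [wl exy|exy].
  case: (ltngtP x y) => [lt|lt|/val_inj e]; last by rewrite e eqxx in xy.
    exact: (wl x y).
  by apply: (wl y x) => //; rewrite eq_sym.
by exists x, y; rewrite lt_xy (leq_trans _ ms) // -ltnS.
Qed.

(* Among the first [w i] items of a long enough packing, some consecutive ones
   have total weight a positive multiple of [w i]; all but one copy of [w i]
   of that total can be packed with type [i] instead. *)
Lemma reachable_sub n (N : {set 'I_n}) w R i t :
  i \in N -> (forall j, 0 < w j <= R) -> R * w i <= t ->
  reachable N w t -> reachable N w (t - w i).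
Proof.
move=> iN wR Rt [s Ns st].
have [wi0 wiR] := andP (wR i).
have le_size : w i <= size s.
  (* No item weighs more than [R], so a total of at least [R * w i] takes at least [w i] items. *)
  have : t <= R * size s.
    rewrite -st -sum1_size big_distrr /= leq_sum // => j _.
    by rewrite muln1; case/andP: (wR j).
  by move/(leq_trans Rt); rewrite leq_pmul2l // (leq_trans wi0).
have [|a [b [/andP[ab bs] eqm]]] := @prefix_sums_congruent _ w (w i) s.
  by rewrite wi0.
pose mid := drop a (take b s).
have e1 : take b s = take a s ++ mid.
  by rewrite -[LHS](cat_take_drop a) take_takel // ltnW.
have mid_gt0 : 0 < \sum_(j <- mid) w j.
  have : 0 < size mid by rewrite size_drop size_takel // subn_gt0.
  case: mid {e1} => // j r _; rewrite big_cons.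
  by case/andP: (wR j) => + _; lia.
have dvd_mid : w i %| \sum_(j <- mid) w j.
  move/eqP: eqm; rewrite e1 big_cat /= eq_sym -{2}[\sum_(j <- take a s) _]addn0.
  by rewrite eqn_modDl mod0n.
have [k ek] := dvdnP dvd_mid.
have k0 : 0 < k by move: mid_gt0; rewrite ek muln_gt0 => /andP[].
have es : s = take a s ++ mid ++ drop b s.
  by rewrite catA -e1 cat_take_drop.
have -> : t - w i = \sum_(j <- take a s) w j
    + (w i * k.-1 + \sum_(j <- drop b s) w j).
  rewrite -st {1}es !big_cat /= ek.
  by case: k k0 {ek} => // k _; rewrite mulSn mulnC /=; lia.
have sub_s r : {subset r <= s} -> all (mem N) r.
  by move=> rs; apply/allP => j /rs; apply: (allP Ns).
apply: reachableD; last apply: reachableD.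
- by exists (take a s) => //; apply: sub_s => j; apply: mem_take.
- exact: reachableM.
- by exists (drop b s) => //; apply: sub_s => j; apply: mem_drop.
Qed.

(** Copies of [w i] are removed one at a time by [reachable_sub]. If the weight drops below
    [R * w i] early, it is already at most [c] and the process stops. *)
Lemma reachable_reduce n (N : {set 'I_n}) w R i c q t :
  i \in N -> (forall j, 0 < w j <= R) -> R * w i <= c ->
  reachable N w t -> t <= c + q * w i ->
  exists t', [/\ reachable N w t', t' <= c & t <= t' + q * w i].
Proof.
move=> iN wR Rc; elim: q t => [|q IH] t rt le_t.
  by exists t; split=> //; lia.
have [lt_t|le_Rt] := ltnP t (R * w i).
  by exists t; split=> //; lia.
have [|t' [rt' t'c tt']] := IH _ (reachable_sub iN wR le_Rt rt).
  by move: le_t; rewrite mulSn; lia.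
by exists t'; split=> //; rewrite mulSn; lia.
Qed.

(** * Profit against weight on the densest types *)

(** Cross-multiplied, the comparison of densities is a test on natural numbers, which the machine
    can perform. *)
Lemma mem_best_types n (p w : 'I_n.+1 -> nat) j :
  (forall i, 0 < w i) ->
  (j \in best_types p w) = (p j * w ord0 == p ord0 * w j).
Proof.
move=> w0; rewrite inE /density GRing.eqr_div ?Num.Theory.pnatr_eq0 -?lt0n //.
by rewrite -!GRing.natrM Num.Theory.eqr_nat.
Qed.

(** On the densest types profit is weight times the constant [p ord0 / w ord0], so maximizing one
    maximizes the other. *)
Lemma optimal_best_types n (p w : 'I_n.+1 -> nat) c x :
  (forall i, 0 < w i) ->
  feasible (best_types p w) w c x ->
  (forall t, reachable (best_types p w) w t -> t <= c ->
     t <= \sum_(j in best_types p w) w j * x j) ->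
  optimal (best_types p w) p w c x.
Proof.
move=> w0 fx max_x; split=> // y fy.
have scale (z : 'I_n.+1 -> nat) :
    w ord0 * \sum_(j in best_types p w) p j * z j =
    p ord0 * \sum_(j in best_types p w) w j * z j.
  rewrite !big_distrr /=; apply: eq_bigr => j.
  by rewrite mem_best_types // => /eqP e; rewrite !mulnA [w ord0 * _]mulnC e.
rewrite -(leq_pmul2l (w0 ord0)) !scale leq_mul //.
exact: max_x (reachable_sum _ _ _) fy.
Qed.

(** * The dynamic programming table *)

(* [T t] is [0] if no packing of weight [t] exists, and otherwise one more than
   the number of a type that can be removed from such a packing; [T 0] is an
   arbitrary nonzero number. *)
Definition last_type n (N : {set 'I_n}) w (T : nat -> nat) t (i : 'I_n) : bool :=
  [&& i \in N, w i <= t & T (t - w i) != 0].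

(** Here [m] counts the types tried so far: a zero entry only excludes those, which makes this an
    invariant of the loop over types. *)
Definition row_ok n (N : {set 'I_n}) w (T : nat -> nat) t m : Prop :=
  (T t = 0 -> forall i : 'I_n, i < m -> ~~ last_type N w T t i) /\
  (T t != 0 -> exists2 i : 'I_n, T t = i.+1 & last_type N w T t i).

Definition table_ok n (N : {set 'I_n}) w (T : nat -> nat) m : Prop :=
  T 0 != 0 /\ forall t, 0 < t < m -> row_ok N w T t n.

(** Weights are positive, so only entries strictly before [t] are consulted; writing entry [t]
    itself is harmless. *)
Lemma eq_last_type n (N : {set 'I_n}) w T T' t i :
  (forall j, 0 < w j) -> (forall k, k < t -> T k = T' k) ->
  last_type N w T t i = last_type N w T' t i.
Proof.
move=> w0 eT; rewrite /last_type; case: (i \in N) => //=.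
case: leqP => //= le; rewrite eT //.
by have := w0 i; lia.
Qed.

Lemma eq_row_ok n (N : {set 'I_n}) w T T' t m :
  (forall j, 0 < w j) -> (forall k, k <= t -> T k = T' k) ->
  row_ok N w T t m -> row_ok N w T' t m.
Proof.
move=> w0 eT.
have elt i : last_type N w T t i = last_type N w T' t i.
  by apply: eq_last_type => // k /ltnW; apply: eT.
rewrite /row_ok eT // => -[z nz]; split=> [/z {}z i /z|/nz[i Ti li]].
  by rewrite elt.
by exists i => //; rewrite -elt.
Qed.

Lemma eq_table_ok n (N : {set 'I_n}) w T T' m :
  (forall j, 0 < w j) -> 0 < m -> (forall k, k < m -> T k = T' k) ->
  table_ok N w T m -> table_ok N w T' m.
Proof.
move=> w0 m0 eT [T0 rows]; split; first by rewrite -eT.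
move=> t /andP[t0 tm]; apply: (eq_row_ok w0 (T := T)); last by apply: rows; rewrite t0.
by move=> k kt; apply/eT/(leq_ltn_trans kt).
Qed.

(** Strong induction on [t]: without its first item the packing has a smaller weight, whose entry is
    nonzero by induction. That item then qualifies for entry [t], which cannot be 0. *)
Lemma table_reachable n (N : {set 'I_n}) w T m t :
  (forall j, 0 < w j) -> table_ok N w T m -> t < m -> reachable N w t ->
  T t != 0.
Proof.
move=> w0 [T0 rows]; elim/ltn_ind: t => -[//|t] IH tm [[|i s] /=].
  by rewrite big_nil.
case/andP=> iN sN; rewrite big_cons => e.
apply/eqP => z; have := w0 i => wi0.
have [/(_ z i (ltn_ord i)) + _] := rows t.+1 tm.
rewrite /last_type iN -{1}e leq_addr /= => /negP[].
apply: IH; [lia|lia|exists s => //; lia].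
Qed.

(** * Resource bounds and a program logic for the machine *)

Fixpoint value (s : store) (e : expr) : nat :=
  match e with
  | Const k => k
  | Read a e1 => s (a, value s e1)
  | Bin o e1 e2 => apply_binop o (value s e1) (value s e2)
  end.

Fixpoint expr_time (e : expr) : nat :=
  match e with
  | Const _ => 1
  | Read _ e1 => (expr_time e1).+1
  | Bin _ e1 e2 => (expr_time e1 + expr_time e2).+1
  end.

(* If all cells are at most [X >= 2], then evaluating [e] only involves numbers
   that are at most [X ^ expr_degree e]; for constants, this is [k <= X ^ k]. *)
Fixpoint expr_degree (e : expr) : nat :=
  match e with
  | Const k => k
  | Read _ e1 => (expr_degree e1).+1
  | Bin _ e1 e2 => (expr_degree e1 + expr_degree e2).+1
  end.

(** Maxima suffice: every write is required to store a number at most [X], so the growth inside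
    expressions does not compound along an execution. *)
Fixpoint cmd_degree (k : cmd) : nat :=
  match k with
  | Skip => 0
  | Write _ e1 e2 => maxn (expr_degree e1) (expr_degree e2)
  | Seq k1 k2 => maxn (cmd_degree k1) (cmd_degree k2)
  | If e k1 k2 => maxn (expr_degree e) (maxn (cmd_degree k1) (cmd_degree k2))
  | While e k1 => maxn (expr_degree e) (cmd_degree k1)
  end.

(** Space is bounded by confining all accesses to a rectangle of [B.1] arrays with [B.2] positions
    each. *)
Definition below (B : cell) (l : cell) : bool := (l.1 < B.1) && (l.2 < B.2).

Fixpoint reads_below (B : cell) (s : store) (e : expr) : bool :=
  match e with
  | Const _ => true
  | Read a e1 => reads_below B s e1 && below B (a, value s e1)
  | Bin _ e1 e2 => reads_below B s e1 && reads_below B s e2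
  end.

Lemma apply_binop_le o x y X a b :
  1 < X -> x <= X ^ a -> y <= X ^ b -> apply_binop o x y <= X ^ (a + b).+1.
Proof.
move=> X1 xa yb; have X0 : 0 < X by apply: ltnW.
have posX m : 0 < X ^ m by rewrite expn_gt0 X0.
have xM : x <= X ^ (a + b).+1.
  by apply: (leq_trans xa); rewrite leq_pexp2l // leqW // leq_addr.
have bool_le (c : bool) : c <= X ^ (a + b).+1 by case: c.
case: o => /=.
(* Both summands are at most [X ^ (a + b)], and the factor 2 is absorbed by one more factor
   [X >= 2]. *)
- have le1 : x <= X ^ (a + b).
    by apply: (leq_trans xa); rewrite leq_pexp2l // leq_addr.
  have le2 : y <= X ^ (a + b).
    by apply: (leq_trans yb); rewrite leq_pexp2l // leq_addl.
  by rewrite expnS (leq_trans (leq_add le1 le2)) // addnn -mul2n leq_mul2r X1 orbT.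
- by apply: leq_trans xM; rewrite leq_subr.
- by rewrite (leq_trans (leq_mul xa yb)) // -expnD leq_pexp2l.
- by apply: leq_trans xM; rewrite leq_div.
- by apply: leq_trans xM; rewrite leq_mod.
- exact: bool_le.
- exact: bool_le.
Qed.

Lemma eval_usage X B s e :
  1 < X -> (forall l, s l <= X) -> reads_below B s e ->
  exists u, [/\ eval s e = (value s e, u), time_used u = expr_time e,
    all (below B) (touched u), peak u <= X ^ expr_degree e
    & value s e <= X ^ expr_degree e].
Proof.
move=> X1 sX; have X0 : 0 < X by apply: ltnW.
elim: e => [k _|a e IH /= /andP[/IH[u [-> tu bu pu vu]] lB]|o e1 IH1 e2 IH2].
- have kX : k <= X ^ k by rewrite ltnW // ltn_expl.
  by exists (Usage 1 [::] k).
- have sXe : s (a, value s e) <= X ^ (expr_degree e).+1.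
    by rewrite (leq_trans (sX _)) // expnS leq_pmulr // expn_gt0 X0.
  eexists; split; [reflexivity|by rewrite /= tu addn1| | |by []].
  + by rewrite /= all_cat bu /= lB.
  + by rewrite /= geq_max sXe (leq_trans pu) // leq_pexp2l.
- move=> /= /andP[/IH1[u1 [-> t1 b1 q1 v1]] /IH2[u2 [-> t2 b2 q2 v2]]].
  have vX := apply_binop_le o X1 v1 v2.
  eexists; split; [reflexivity|by rewrite /= t1 t2 addn1| | |exact: vX].
  + by rewrite /= cats0 all_cat b1.
  + rewrite /= !geq_max vX (leq_trans q1) ?(leq_trans q2) //;
      by rewrite leq_pexp2l // leqW ?leq_addr ?leq_addl.
Qed.

(* The bound [X] on the contents of the cells is part of both the precondition
   and the postcondition; the first argument of [Q] is the running time. *)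
Definition wp X B (k : cmd) (s : store) (Q : nat -> store -> Prop) : Prop :=
  (forall l, s l <= X) ->
  exists u s', [/\ exec k s u s', Q (time_used u) s', forall l, s' l <= X,
    all (below B) (touched u) & peak u <= X ^ cmd_degree k].

Lemma wp_weaken X B k s (Q Q' : nat -> store -> Prop) :
  wp X B k s Q -> (forall t s', (forall l, s' l <= X) -> Q t s' -> Q' t s') ->
  wp X B k s Q'.
Proof.
by move=> wpk QQ' /wpk[u [s' [ek Qs' bs' tu pu]]]; exists u, s'; split=> //; apply: QQ'.
Qed.

Lemma wp_skip X B s (Q : nat -> store -> Prop) : Q 1 s -> wp X B Skip s Q.
Proof. by move=> Qs sX; exists tick, s; split=> //; apply: exec_skip. Qed.

Lemma wp_write X B a ei ev s (Q : nat -> store -> Prop) :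
  1 < X -> reads_below B s ei -> reads_below B s ev ->
  below B (a, value s ei) ->
  ((forall l, s l <= X) -> value s ev <= X) ->
  Q (expr_time ei + expr_time ev).+1 (update s (a, value s ei) (value s ev)) ->
  wp X B (Write a ei ev) s Q.
Proof.
move=> X1 ri rv lB vX Qs sX.
have [ui [ei_eq ti bi pi _]] := eval_usage X1 sX ri.
have [uv [ev_eq tv bv pv vv]] := eval_usage X1 sX rv.
do 2 eexists; split; first exact: exec_write ei_eq ev_eq.
- by rewrite /= ti tv addn1.
- by move=> l; rewrite /update; case: ifP => _ //; apply: vX.
- by rewrite /= !all_cat bi bv /= lB.
- have X0 : 0 < X by apply: ltnW.
  rewrite /= !geq_max -andbA; apply/and3P; split.
  + by rewrite (leq_trans pi) // leq_pexp2l // leq_maxl.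
  + by rewrite (leq_trans pv) // leq_pexp2l // leq_maxr.
  + by rewrite (leq_trans vv) // leq_pexp2l // leq_maxr.
Qed.

Lemma wp_seq X B k1 k2 s (Q : nat -> store -> Prop) :
  0 < X ->
  wp X B k1 s (fun t1 s1 => wp X B k2 s1 (fun t2 => Q (t1 + t2))) ->
  wp X B (Seq k1 k2) s Q.
Proof.
move=> X0 wp1 /wp1[u1 [s1 [e1 wp2 /wp2[u2 [s2 [e2 Qs2 s2X b2 q2]]] b1 q1]]].
do 2 eexists; split; [exact: exec_seq e1 e2|exact: Qs2|exact: s2X| |].
- by rewrite /= all_cat b1.
- rewrite /= geq_max (leq_trans q1) ?(leq_trans q2) //;
    by rewrite leq_pexp2l // ?leq_maxl ?leq_maxr.
Qed.

Lemma wp_if X B e k1 k2 s (Q : nat -> store -> Prop) :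
  1 < X -> reads_below B s e ->
  (value s e != 0 -> wp X B k1 s (fun t => Q (expr_time e + t).+1)) ->
  (value s e = 0 -> wp X B k2 s (fun t => Q (expr_time e + t).+1)) ->
  wp X B (If e k1 k2) s Q.
Proof.
move=> X1 re wp1 wp2 sX; have X0 : 0 < X by apply: ltnW.
have [ue [e_eq te be pe _]] := eval_usage X1 sX re.
pose k := if value s e != 0 then k1 else k2.
have [u [s' [ek Qs' s'X bu pu]]] : exists u s', [/\ exec k s u s',
    Q (expr_time e + time_used u).+1 s', forall l, s' l <= X,
    all (below B) (touched u) & peak u <= X ^ cmd_degree k].
  rewrite /k; case: eqP => [/wp2|/eqP/wp1]; exact.
do 2 eexists; split; [exact: exec_if e_eq ek| |exact: s'X| |].
- by rewrite /= te add1n addSn.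
- by rewrite /= all_cat be.
- rewrite /= max0n geq_max (leq_trans pe) ?(leq_trans pu) // leq_pexp2l //.
    by rewrite /k; case: ifP; rewrite !leq_max leqnn ?orbT.
  by rewrite leq_maxl.
Qed.

(** The variant [m] bounds the number of iterations, so termination and running time come from one
    induction on it. *)
Lemma wp_while X B e k (I : store -> Prop) (m : store -> nat) tk s :
  1 < X -> I s -> (forall s1, I s1 -> reads_below B s1 e) ->
  (forall s1, I s1 -> value s1 e != 0 ->
     wp X B k s1 (fun t s2 => [/\ I s2, m s2 < m s1 & t <= tk])) ->
  wp X B (While e k) s (fun t s' =>
    [/\ I s', value s' e = 0 & t <= m s * (expr_time e + tk).+1 + (expr_time e).+1]).
Proof.
move=> X1 Is re step; have X0 : 0 < X by apply: ltnW.
have [M] := ubnP (m s); elim: M s Is => // M IH s Is mM sX.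
have [ue [e_eq te be pe _]] := eval_usage X1 sX (re s Is).
have pe' : peak ue <= X ^ cmd_degree (While e k).
  by rewrite (leq_trans pe) // leq_pexp2l // leq_maxl.
have [e0|e0] := eqVneq (value s e) 0.
  rewrite e0 in e_eq; do 2 eexists; split; first exact: exec_while_stop e_eq.
  - by split=> //; rewrite /= te; lia.
  - exact: sX.
  - exact: be.
  - by rewrite /= max0n.
have [u1 [s1 [e1 [Is1 m1 t1] s1X b1 q1]]] := step s Is e0 sX.
have [|u2 [s2 [e2 [Is2 z2 t2] s2X b2 q2]]] := IH s1 Is1 _ s1X.
  by rewrite (leq_trans m1).
do 2 eexists; split; [exact: exec_while_loop e_eq e0 e1 e2| |exact: s2X| |].
- split=> //=; rewrite te.
  have : m s1 * (expr_time e + tk).+1 + (expr_time e + tk).+1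
           <= m s * (expr_time e + tk).+1 by rewrite addnC -mulSn leq_mul2r m1.
  lia.
- by rewrite /= !all_cat be b1.
- rewrite /= max0n !geq_max pe' q2 (leq_trans q1) //.
  by rewrite leq_pexp2l // leq_maxr.
Qed.

Lemma space_used_below B u :
  all (below B) (touched u) -> space_used u <= B.1 * B.2.
Proof.
move=> /allP bu; pose L := [seq (a, i) | a <- iota 0 B.1, i <- iota 0 B.2].
have -> : B.1 * B.2 = size L by rewrite size_allpairs !size_iota.
apply: uniq_leq_size (undup_uniq _) _ => l; rewrite mem_undup => /bu/andP[l1 l2].
by rewrite [l]surjective_pairing allpairs_f // mem_iota.
Qed.

(** * The program *)

Definition var (a : nat) : expr := Read a (Const 0).
Definition set_var (a : nat) (e : expr) : cmd := Write a (Const 0) e.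

(* Array 4 is the table, and the scalar variables are: 5, the number of copies
   of type 0 set aside; 6, the capacity that remains; 7, the weight of the
   current table entry; 8, an item type; 9, the largest weight known to be
   reachable, later the weight still to be packed.  If the current type is
   heavier than the current entry, then the truncated subtraction makes
   [try_type] read entry 0, and the comparison discards the result. *)
Definition try_type : cmd :=
  Seq
    (If (Bin OpMul
          (Bin OpEq (Bin OpMul (Read 1 (var 8)) (var 2))
                    (Bin OpMul (var 1) (Read 2 (var 8))))
          (Bin OpMul
            (Bin OpLt (Read 2 (var 8)) (Bin OpAdd (var 7) (Const 1)))
            (Read 4 (Bin OpSub (var 7) (Read 2 (var 8))))))
        (Write 4 (var 7) (Bin OpAdd (var 8) (Const 1)))
        Skip)
    (set_var 8 (Bin OpAdd (var 8) (Const 1))).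

Definition fill_entry : cmd :=
  Seq (set_var 8 (Const 0)) (While (Bin OpLt (var 8) (var 0)) try_type).

Definition fill_table : cmd :=
  While (Bin OpLt (var 7) (Bin OpAdd (var 6) (Const 1)))
    (Seq fill_entry
    (Seq (If (Read 4 (var 7)) (set_var 9 (var 7)) Skip)
         (set_var 7 (Bin OpAdd (var 7) (Const 1))))).

Definition trace_back : cmd :=
  While (var 9)
    (Seq (set_var 8 (Bin OpSub (Read 4 (var 9)) (Const 1)))
    (Seq (Write 3 (var 8) (Bin OpAdd (Read 3 (var 8)) (Const 1)))
         (set_var 9 (Bin OpSub (var 9) (Read 2 (var 8)))))).

(** Scalars live at position 0: [set_var 4 (Const 1)] marks table entry 0, the empty packing, and
    the last write adds the copies set aside to the count of type 0. For [c <= R * R] the truncated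
    subtraction sets no copy aside. *)
Definition knapsack : cmd :=
  Seq (set_var 5 (Bin OpDiv (Bin OpSub (Read 0 (Const 2))
                    (Bin OpMul (Read 0 (Const 1)) (Read 0 (Const 1)))) (var 2)))
  (Seq (set_var 6 (Bin OpSub (Read 0 (Const 2)) (Bin OpMul (var 5) (var 2))))
  (Seq (set_var 4 (Const 1))
  (Seq (set_var 7 (Const 1))
  (Seq fill_table
  (Seq trace_back
       (set_var 3 (Bin OpAdd (var 3) (var 5)))))))).

Lemma updateE s a i v b j :
  update s (a, i) v (b, j) = if (b == a) && (j == i) then v else s (b, j).
Proof. by []. Qed.

(** The program never writes arrays 0 to 2, so this holds throughout the run. *)
Definition has_input R n (p w : 'I_n -> nat) c (s : store) : Prop :=
  forall a i, a < 3 -> s (a, i) = input_store R p w c (a, i).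

Definition table (s : store) (t : nat) : nat := s (4, t).

(** * Correctness and running time of the program *)

Section Correctness.

(** [X] caps the stored numbers and [S] the positions. The term [c + c] below accommodates the final
    count of type 0, a sum of two numbers that are at most [c]. *)
Variables (R n : nat) (p w : 'I_n.+1 -> nat) (c X S : nat).
Hypothesis wR : forall j, 0 < w j <= R.
Hypothesis nR : n < R.
Hypothesis RX : R + c + c < X.

Let N := best_types p w.
Let B : cell := (10, S).

Let w_gt0 j : 0 < w j. Proof. by case/andP: (wR j). Qed.
Let X_gt1 : 1 < X. Proof. lia. Qed.
Let X_gt0 : 0 < X. Proof. lia. Qed.

Lemma read_profit s (j : 'I_n.+1) : has_input R p w c s -> s (1, j : nat) = p j.
Proof. by move=> ->; rewrite // /input_store /= valK. Qed.

Lemma read_weight s (j : 'I_n.+1) : has_input R p w c s -> s (2, j : nat) = w j.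
Proof. by move=> ->; rewrite // /input_store /= valK. Qed.

Definition same_outside (P : pred cell) (s s' : store) : Prop :=
  forall l, ~~ P l -> s' l = s l.

Definition entry_cells t : pred cell := pred2 (4, t) (8, 0).

Lemma has_input_same P s s' :
  (forall a i, a < 3 -> ~~ P (a, i)) -> same_outside P s s' ->
  has_input R p w c s -> has_input R p w c s'.
Proof. by move=> Pin ss' Is a i a3; rewrite ss' ?Is ?Pin. Qed.

Lemma try_type_wp t s :
  has_input R p w c s -> s (7, 0) = t -> 0 < t <= c -> R + t < S ->
  s (8, 0) <= n -> row_ok N w (table s) t (s (8, 0)) ->
  wp X B try_type s (fun tm s' =>
    [/\ same_outside (entry_cells t) s s', s' (8, 0) = (s (8, 0)).+1,
      row_ok N w (table s') t (s' (8, 0)) & tm <= 50]).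
Proof.
move=> Is e7 /andP[t0 tc] tS jn row.
pose i : 'I_n.+1 := Ordinal (jn : s (8, 0) < n.+1).
have pj : s (1, s (8, 0)) = p i := read_profit i Is.
have wj : s (2, s (8, 0)) = w i := read_weight i Is.
have p0 : s (1, 0) = p ord0 := read_profit ord0 Is.
have w0 : s (2, 0) = w ord0 := read_weight ord0 Is.
apply: wp_seq => //; apply: wp_if => //.
- by rewrite /= /below /= wj e7; lia.
(* The guard is a product used as a conjunction; it is nonzero exactly when type [i] satisfies
   [last_type]. *)
- rewrite /= pj wj p0 w0 e7 !muln_eq0 !eqb0 !negb_or !negbK addn1 ltnS.
  rewrite -mem_best_types // => ok.
  apply: wp_write => //.
  + by rewrite /= /below /=; lia.
  + by rewrite /= /below /=; lia.
  + by rewrite /= /below /= ?e7; lia.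
  + by move=> _ /=; lia.
  rewrite /= ?e7 addn1; apply: wp_write => //.
  + by rewrite /= /below /=; lia.
  + by rewrite /= /below /=; lia.
  + by move=> _; rewrite /= updateE /=; lia.
  rewrite /= !updateE /= addn1; split=> //.
  + move=> [a k]; rewrite /entry_cells /= negb_or /update => /andP[/negPf h1 /negPf h2].
    by rewrite h1 h2.
  + split; rewrite /table !updateE !eqxx //= => _; exists i => //.
    rewrite (@eq_last_type _ _ _ _ (table s)) // => k kt.
    by rewrite /table !updateE /= (ltn_eqF kt).
- rewrite /= pj wj p0 w0 e7 addn1 ltnS -mem_best_types // => /eqP ok.
  apply: wp_skip; apply: wp_write => //.
  + by rewrite /= /below /=; lia.
  + by rewrite /= /below /=; lia.
  + by move=> _ /=; lia.
  rewrite /= !updateE /= addn1; split=> //.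
  + move=> [a k]; rewrite /entry_cells /= negb_or /update => /andP[/negPf h1 /negPf h2].
    by rewrite h2.
  + case: row => z nz; split=> [/z {}z k|/nz //].
    rewrite ltnS leq_eqVlt => /predU1P[ek|/z //].
    (* The only type not yet covered by [row] is the one whose test has just failed. *)
    have -> : k = i by apply: val_inj.
    apply: contraL ok => /and3P[iN wt nzt].
    by rewrite !muln_eq0 !eqb0 !negb_or !negbK; apply/and3P.
Qed.

Lemma fill_entry_wp t s :
  has_input R p w c s -> s (7, 0) = t -> 0 < t <= c -> R + t < S ->
  table_ok N w (table s) t -> table s t = 0 ->
  wp X B fill_entry s (fun tm s' =>
    [/\ same_outside (entry_cells t) s s', table_ok N w (table s') t.+1
      & tm <= 60 * R + 20]).
Proof.
move=> Is e7 t0c tS tab z.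
have [t0 tc] := andP t0c.
have Pin a k : a < 3 -> ~~ entry_cells t (a, k).
  by move=> a3; rewrite /entry_cells /= !xpair_eqE; lia.
apply: wp_seq => //; apply: wp_write => //.
  by rewrite /= /below /=; lia.
rewrite /=; set s0 := update _ _ _.
pose I s' := [/\ same_outside (entry_cells t) s s', s' (8, 0) <= n.+1
  & row_ok N w (table s') t (s' (8, 0))].
have II s' : I s' -> has_input R p w c s' by case=> /has_input_same h _ _; apply: h Is.
have I0 : I s0.
  split=> //.
    move=> [a k]; rewrite /entry_cells /= negb_or /s0 /update => /andP[_ /negPf ->] //.
  (* With no type tried and entry [t] still 0, both halves of [row_ok] are vacuous. *)
  by split=> //; rewrite /table /s0 updateE /= => /eqP[].
apply: wp_weaken.
  apply: (wp_while (I := I) (m := fun s' => n.+1 - s' (8, 0)) (tk := 50)) => //.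
    move=> s1 _; rewrite /= /below /=; lia.
  move=> s1 I1; have Is1 := II _ I1; case: I1 => ss1 jn1 row1.
  have e0 : s1 (0, 0) = n.+1 by rewrite Is1.
  rewrite /= e0 eqb0 negbK => jn.
  have e71 : s1 (7, 0) = t by rewrite ss1.
  apply: wp_weaken; first exact: (try_type_wp (t := t)).
  move=> tm s2 _ [ss2 e82 row2 tm_le]; split=> //; last by rewrite e82; lia.
  by split; [move=> l ll; rewrite ss2 ?ss1|rewrite e82|].
move=> tm s' _ [[ss' jn' row']]; rewrite /= => end_j tm_le.
have Is' : has_input R p w c s' by apply: II.
have e0 : s' (0, 0) = n.+1 by rewrite Is'.
have ej : s' (8, 0) = n.+1.
  by apply/eqP; rewrite eqn_leq jn' /= leqNgt -e0 -eqb0 end_j.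
split=> //.
  have [T0 rows] : table_ok N w (table s') t.
    apply: eq_table_ok tab => // k kt.
    by rewrite /table ss' // /entry_cells /= !xpair_eqE (ltn_eqF kt).
  split=> // k /andP[k0]; rewrite ltnS leq_eqVlt => /predU1P[->|kt].
    by rewrite ej in row'.
  by apply: rows; rewrite k0.
have : (n.+1 - s0 (8, 0)) <= R by lia.
move: tm_le; rewrite /=; nia.
Qed.


Definition best_entry (s : store) m : Prop :=
  [/\ s (9, 0) < m, table s (s (9, 0)) != 0
    & forall k, s (9, 0) < k < m -> table s k = 0].

Definition table_cells : pred cell := [pred l | l.1 \in [:: 4; 7; 8; 9]].

Lemma fill_table_wp cap s :
  has_input R p w c s -> s (6, 0) = cap -> s (7, 0) = 1 -> s (9, 0) = 0 ->
  table s 0 != 0 -> (forall k, 0 < k -> table s k = 0) ->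
  cap <= c -> R + cap < S ->
  wp X B fill_table s (fun tm s' =>
    [/\ same_outside table_cells s s', table_ok N w (table s') cap.+1,
      best_entry s' cap.+1 & tm <= cap * (60 * R + 60) + 20]).
Proof.
move=> Is e6 e7 e9 T0 Tz capc capS.
(* The last clause keeps the entries not yet processed at 0, as [fill_entry_wp] requires of its
   entry. *)
pose I s' := [/\ same_outside table_cells s s', 0 < s' (7, 0) <= cap.+1,
  table_ok N w (table s') (s' (7, 0)), best_entry s' (s' (7, 0))
  & forall k, s' (7, 0) <= k -> table s' k = 0].
have I0 : I s.
  split=> //; first by rewrite e7.
  - by split=> // k; rewrite e7; lia.
  - by split; rewrite ?e9 ?e7 // => k; lia.
  - by rewrite e7.
have II s' : I s' -> has_input R p w c s'.
  by case=> ss' _ _ _ _; apply: (has_input_same _ ss') => // -[|[|[]]].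
apply: wp_weaken.
  apply: (wp_while (I := I) (m := fun s' => cap.+1 - s' (7, 0))
    (tk := 60 * R + 50)) => // [s1 _|s1 I1].
    by rewrite /= /below /=; lia.
  have Is1 := II _ I1; case: I1 => ss1 t_le tab1 best1 z1.
  have e61 : s1 (6, 0) = cap by rewrite ss1.
  rewrite /= e61 addn1 eqb0 negbK ltnS => tcap.
  apply: wp_seq => //; apply: wp_weaken.
    apply: (fill_entry_wp (t := s1 (7, 0))) => //; [lia|lia|exact: z1].
  move=> tm2 s2 _ [ss2 tab2 tm2_le].
  have e72 : s2 (7, 0) = s1 (7, 0) by rewrite ss2.
  have e92 : s2 (9, 0) = s1 (9, 0) by rewrite ss2.
  have T2 k : k != s1 (7, 0) -> table s2 k = table s1 k.
    by move=> kt; rewrite /table ss2 // /entry_cells /= !xpair_eqE (negPf kt).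
  have z2 k : s1 (7, 0) < k -> table s2 k = 0.
    by move=> tk; rewrite T2 ?z1 // ?(ltnW tk) // gtn_eqF.
  have same2 : same_outside table_cells s s2.
    move=> [a k] ll; rewrite -(ss1 (a, k)) //; apply: ss2; apply: contra ll.
    by rewrite /entry_cells /table_cells /= !inE !xpair_eqE; lia.
  have [b1 b2 b3] := best1.
  rewrite /=; apply: wp_seq => //.
  pose J tm s3 := [/\ same_outside table_cells s s3, s3 (7, 0) = s1 (7, 0),
    table s3 =1 table s2, best_entry s3 (s1 (7, 0)).+1 & tm <= 20].
  apply: (wp_weaken (Q := J)).
    apply: wp_if => //.
    - by rewrite /= /below /=; lia.
    - rewrite /= e72 => nz; apply: wp_write => //.
      + by rewrite /= /below /=; lia.
      + by rewrite /= /below /=; lia.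
      + by move=> s2X /=; apply: s2X.
      rewrite /= e72; split=> //.
      + move=> [a k] ll; rewrite updateE same2 //; case: eqP ll => [->|] //.
      + by split; rewrite ?updateE //= => k; lia.
    - rewrite /= e72 => z; apply: wp_skip; split=> //; split; rewrite e92 ?T2 //.
      + by rewrite ltnW.
      + by rewrite (ltn_eqF b1).
      move=> k /andP[bk]; rewrite ltnS leq_eqVlt => /predU1P[->//|kt].
      by rewrite T2 ?(ltn_eqF kt) // b3 // bk.
  move=> tm3 s3 _ [ss3 e73 T3 best3 tm3_le].
  rewrite /=; apply: wp_write => //.
  - by rewrite /= /below /=; lia.
  - by rewrite /= /below /=; lia.
  - by move=> _ /=; rewrite e73; lia.
  rewrite /= e73 addn1; split; last by lia.
  - split; rewrite ?updateE //=.
    + move=> [a k] ll; rewrite updateE ss3 //; case: eqP ll => [->|] //.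
    + apply: eq_table_ok tab2 => // k _; rewrite -T3 //.
    + by move=> k tk; rewrite -[LHS]/(table s3 k) T3 z2.
  - by rewrite updateE /=; lia.
move=> tm s' _ [[ss' t_le tab best z]] /=.
have -> : s' (6, 0) = cap by rewrite ss'.
rewrite addn1 => /eqP; rewrite eqb0 -leqNgt => t_ge tm_le.
have e7' : s' (7, 0) = cap.+1 by lia.
rewrite e7' in tab best; split=> //.
by move: tm_le; rewrite e7; nia.
Qed.

Definition trace_cells : pred cell := [pred l | l.1 \in [:: 3; 8; 9]].

(** Packed weight plus remaining weight is invariant, and the remaining weight always has a nonzero
    entry, which names the next item. Positive weights make it decrease strictly, so it serves as
    the variant. *)
Lemma trace_back_wp m s :
  has_input R p w c s -> table_ok N w (table s) m ->
  s (9, 0) < m -> s (9, 0) <= c -> R + m < S -> table s (s (9, 0)) != 0 ->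
  (forall k, s (3, k) = 0) ->
  wp X B trace_back s (fun tm s' =>
    [/\ same_outside trace_cells s s',
      \sum_(j in N) w j * s' (3, j : nat) = s (9, 0)
      & tm <= s (9, 0) * 60 + 20]).
Proof.
move=> Is [T0 rows] bm bc mS Tb out0.
pose packed s' := \sum_(j in N) w j * s' (3, j : nat).
pose I s' := [/\ same_outside trace_cells s s', table s (s' (9, 0)) != 0
  & packed s' + s' (9, 0) = s (9, 0)].
have packed0 : packed s = 0 by apply: big1 => j _; rewrite out0 muln0.
have II s' : I s' -> has_input R p w c s'.
  by case=> ss' _ _; apply: (has_input_same _ ss') => // -[|[|[]]].
apply: wp_weaken.
  apply: (wp_while (I := I) (m := fun s' => s' (9, 0)) (tk := 50)) => //.
  - by split; rewrite ?packed0.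
  - by move=> s1 _; rewrite /= /below /=; lia.
  move=> s1 I1; have Is1 := II _ I1; case: I1 => ss1 nz1 sum1 /= b0.
  have T1 k : s1 (4, k) = table s k by rewrite ss1.
  have [_ /(_ nz1)[i ti /and3P[iN wi nzi]]] : row_ok N w (table s) (s1 (9, 0)) n.+1.
    by apply: rows; lia.
  have iS := ltn_ord i.
  have wi1 : s1 (2, i : nat) = w i := read_weight i Is1.
  (* A count is at most the weight it contributes; this keeps the incremented count within [X]. *)
  have out_le : s1 (3, i : nat) <= c.
    have : w i * s1 (3, i : nat) <= packed s1 by rewrite /packed (bigD1 i) //= leq_addr.
    by have := w_gt0 i; nia.
  apply: wp_seq => //; apply: wp_write => //.
  - by rewrite /= /below /=; lia.
  - by rewrite /= /below /=; lia.
  - by move=> _; rewrite /= T1 ti; lia.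
  rewrite /= T1 ti subn1 /=; apply: wp_seq => //; apply: wp_write => //.
  - by rewrite /= /below /=; lia.
  - by rewrite /= /below /= !updateE /=; lia.
  - by rewrite /= /below /= !updateE /=; lia.
  - by move=> _; rewrite /= !updateE /=; lia.
  rewrite /= !updateE /= addn1; apply: wp_write => //.
  - by rewrite /= /below /= !updateE /=; lia.
  - by rewrite /= /below /=; lia.
  - by move=> _; rewrite /= !updateE /= wi1; lia.
  rewrite /= !updateE /= wi1; set s4 := update _ _ _.
  have wi0 := w_gt0 i.
  have sum4 : packed s4 = packed s1 + w i.
    have si : s4 (3, i : nat) = (s1 (3, i : nat)).+1.
      by rewrite /s4 !updateE !eqxx.
    have rest : \sum_(j in N | j != i) w j * s4 (3, j : nat)
              = \sum_(j in N | j != i) w j * s1 (3, j : nat).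
      apply: eq_bigr => j /andP[_ ji]; rewrite /s4 !updateE /=.
      by rewrite (negPf (ji : (j : nat) != i)).
    by rewrite /packed (bigD1 i) //= rest [in RHS](bigD1 i) //= si mulnS -addnA addnC.
  split.
  - split; rewrite /s4 ?updateE //=.
    + move=> [a k] ll; rewrite -(ss1 (a, k)) // !updateE.
      move: ll; rewrite /trace_cells !inE /= !negb_or.
      by case/and3P=> /negPf-> /negPf-> /negPf->.
    + rewrite -/s4 sum4; lia.
  - by lia.
  - by [].
move=> tm s' _ [[ss' _ sum]] /= b0 tm_le; split=> //.
  by move: sum; rewrite b0 addn0.
by move: tm_le; lia.
Qed.

Lemma best_ord0 : ord0 \in N.
Proof. by rewrite /N mem_best_types. Qed.

(** Any packing within [c] loses at most [q * w ord0] when reduced to the remaining capacity, and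
    the [q] copies of type 0 make up for it. The exchange needs room [R * w ord0], but only when [q]
    is positive. *)
Lemma optimal_top_up q best (s s' : store) :
  (0 < q -> R * w ord0 <= c - q * w ord0) -> q * w ord0 <= c ->
  best <= c - q * w ord0 ->
  (forall t, reachable N w t -> t <= c - q * w ord0 -> t <= best) ->
  \sum_(j in N) w j * s (3, j : nat) = best ->
  s' (3, 0) = s (3, 0) + q ->
  (forall k, k != 0 -> s' (3, k) = s (3, k)) ->
  optimal N p w c (@output s' n.+1).
Proof.
move=> Rq qc bc max_b sum0 s0 sk.
have sum' : \sum_(j in N) w j * output s' j = best + q * w ord0.
  rewrite -sum0 !(bigD1 _ best_ord0) /= /output s0 mulnDr addnAC (mulnC q).
  by congr (_ + _ + _); apply: eq_bigr => j /andP[_ j0]; rewrite sk.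
apply: optimal_best_types => // [|t rt tc]; rewrite ?/feasible sum'; first by lia.
have [q0|q0] := posnP q.
  by move: max_b tc; rewrite q0 !mul0n subn0 addn0 => max_b; apply: max_b.
have [|t' [rt' t'c tt']] := reachable_reduce (q := q) best_ord0 wR (Rq q0) rt.
  by rewrite subnK.
by rewrite (leq_trans tt') // leq_add2r max_b.
Qed.

Lemma knapsack_wp :
  R * R + 2 * R + 2 < S ->
  wp X B knapsack (input_store R p w c) (fun tm s =>
    optimal N p w c (@output s n.+1) /\ tm <= 600 * R ^ 3).
Proof.
move=> RS.
have in0 : has_input R p w c (input_store R p w c) by [].
have [w0 w0R] := andP (wR ord0).
set s0 := input_store R p w c.
have e20 : s0 (2, 0) = w ord0 := read_weight ord0 in0.
have e01 : s0 (0, 1) = R by [].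
have e02 : s0 (0, 2) = c by [].
(* Rounding down leaves less than [w ord0] beyond [R * R], whence [cap <= R * R + R]. *)
pose q := (c - R * R) %/ w ord0; pose cap := c - q * w ord0.
have q_le : q * w ord0 <= c - R * R by apply: leq_divM.
have q_mod : c - R * R < q * w ord0 + w ord0.
  by rewrite addnC -mulSn ltn_ceil.
have qc : q <= c by nia.
have capc : cap <= c by rewrite leq_subr.
have capR : cap <= R * R + R by rewrite /cap; lia.
apply: wp_seq => //; apply: wp_write => //.
- by rewrite /= /below /=; lia.
- by rewrite /= /below /=; lia.
- by move=> _; rewrite /= e01 e02 e20 -/q; lia.
rewrite /= e01 e02 e20 -/q; apply: wp_seq => //; apply: wp_write => //.
- by rewrite /= /below /=; lia.
- by rewrite /= /below /=; lia.
- by move=> _; rewrite /= !updateE /= e02 e20 -/cap; lia.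
rewrite /= !updateE /= e02 e20 -/cap; apply: wp_seq => //; apply: wp_write => //.
- by rewrite /= /below /=; lia.
rewrite /=; apply: wp_seq => //; apply: wp_write => //.
- by rewrite /= /below /=; lia.
rewrite /=; set s4 := update _ _ _; apply: wp_seq => //; apply: wp_weaken.
  apply: (fill_table_wp (cap := cap)) => //; last lia.
  - by move=> [|[|[|a]]].
  - by move=> [].
move=> tm5 s5 _ [ss5 tab5 [b1 b2 b3] tm5_le] /=.
have in5 : has_input R p w c s5.
  apply: (has_input_same _ ss5) => [[|[|[]]] //|].
  by move=> [|[|[|a]]].
apply: wp_seq => //; apply: wp_weaken.
  apply: (trace_back_wp (m := cap.+1)) => //; [lia|lia|].
  by move=> k; rewrite ss5.
move=> tm6 s6 s6X [ss6 sum6 tm6_le] /=.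
have in6 : has_input R p w c s6.
  by apply: (has_input_same _ ss6) => // -[|[|[]]].
have e65 : s6 (5, 0) = q by rewrite ss6 // ss5.
have out_le : s6 (3, 0) <= c.
  have : w ord0 * s6 (3, 0) <= s5 (9, 0) by rewrite -sum6 (bigD1 _ best_ord0) leq_addr.
  nia.
apply: wp_write => //.
- by rewrite /= /below /=; lia.
- by rewrite /= /below /=; lia.
- by move=> _; rewrite /= e65; lia.
rewrite /= e65; split.
- apply: (optimal_top_up (q := q) (best := s5 (9, 0)) (s := s6)) => //.
  (* A positive [q] forces [c > R * R], so the remaining capacity is at least [R * R], hence at
     least [R * w ord0]. *)
  + by rewrite -/cap => q0; rewrite /cap; nia.
  + by lia.
  + move=> t rt tc; rewrite leqNgt; apply/negP => bt.
    have := table_reachable w_gt0 tab5 (_ : t < cap.+1) rt.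
    by rewrite b3 ?bt ltnS // => /(_ tc).
  + by move=> k k0; rewrite updateE (negPf k0).
(* Filling the table costs at most [240 * R ^ 3] and tracing back at most [120 * R ^ 2], up to
   constants; 600 covers everything. *)
- have R3 : R ^ 3 = R * R * R by rewrite !expnS expn0; lia.
  have cap2 : cap <= 2 * (R * R) by nia.
  have h1 : cap * (60 * R + 60) <= 2 * (R * R) * (120 * R) by apply: leq_mul; lia.
  have h2 : s5 (9, 0) * 60 <= 2 * (R * R) * 60 by apply: leq_mul; lia.
  have h3 : R * R <= R * R * R by rewrite leq_pmulr; lia.
  have h4 : 0 < R * R by rewrite muln_gt0; lia.
  have h5 : 2 * (R * R) * (120 * R) = 240 * (R * R * R) by lia.
  rewrite R3; lia.
Qed.

End Correctness.

(* One program for all instances.  The last bound says that the unit-cost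
   operations only handle numbers polynomial in [R] and [c], i.e., words of
   O(log (R + c)) bits. *)
Theorem theorem9 :
  exists (prog : cmd) (K d : nat),
    forall (R n : nat) (p w : 'I_n.+1 -> nat),
      0 < R -> n.+1 <= R ->
      (forall j, 0 < p j <= R) ->
      (forall j, 0 < w j <= R) ->
      (forall i j : 'I_n.+1, i <= j -> (density p w j <= density p w i)%R) ->
      forall c : nat,
        exists (u : usage) (s : store),
          [/\ exec prog (input_store R p w c) u s,
              optimal (best_types p w) p w c (@output s n.+1),
              time_used u <= K * R ^ 3,
              space_used u <= K * R ^ 2
            & peak u <= (R + c + 1) ^ d].
Proof.
(* The degree is doubled because the cap [X] on cells is the square of [R + c + 1]. [S] leaves room
   for table positions up to [R * R + R], and the ten arrays of length [S] fit in [600 * R ^ 2]. *)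
exists knapsack, 600, (2 * cmd_degree knapsack) => R n p w R0 nR pR wR _ c.
pose X := (R + c + 1) ^ 2; pose S := R * R + 2 * R + 3.
have XE : X = (R + c + 1) * (R + c + 1) by rewrite /X expnS expn1.
have RX : R + c + c < X by rewrite XE; nia.
have [||u [s [ex [opt tm] _ B_u pk]]] := @knapsack_wp R n p w c X S wR nR RX _.
- by rewrite /S; lia.
- move=> [[|[|[|a]]] i] //=; rewrite /input_store /=.
  + by case: i => [|[|[|i]]] /=; rewrite ?nth_nil; lia.
  + by case: insubP => //= j _ _; case/andP: (pR j); lia.
  + by case: insubP => //= j _ _; case/andP: (wR j); lia.
exists u, s; split=> //; last by rewrite expnM.
apply: (leq_trans (space_used_below B_u)); rewrite /S /= expnS expn1.
have : R <= R * R by rewrite leq_pmulr.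
lia.
Qed.
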